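(* Let $\mathbb{F}$ be a field of characteristic zero, let $W_2$ be the 6-dimensional $\mathbb{F}$-algebra with basis $e_1,\dots,e_6$ defined in the context, and let $Ann_l(W_2)$ be the linear span of $e_4$ and $e_3+e_6$. If $I$ is a non-trivial right ideal of $W_2$, then $I$ is a subspace of $Ann_l(W_2)$.
   Context: Let $V_2$ be a 2-dimensional vector space over $\mathbb{F}$ with basis $v_1,v_2$. $W(2)$ is the vector space of all bilinear maps $V_2\times V_2\to V_2$ with the (not necessarily associative, not necessarily unital) product $$(A\cdot B)(x,y)=A(v_1,B(x,y))-B(A(v_1,x),y)-B(x,A(v_1,y)),\qquad x,y\in V_2.$$ For $i,j,k\in\{1,2\}$ let $\alpha_{ij}^k\in W(2)$ be given by $\alpha_{ij}^k(v_t,v_l)=\delta_{it}\delta_{jl}v_k$. Put $e_1=\alpha_{11}^1-\alpha_{12}^2-\alpha_{21}^2$, $e_2=\alpha_{11}^2$, $e_3=\alpha_{22}^2-\alpha_{12}^1-\alpha_{21}^1$, $e_4=\alpha_{22}^1$, $e_5=2\alpha_{11}^1+\alpha_{12}^2+\alpha_{21}^2$, $e_6=2\alpha_{22}^2+\alpha_{12}^1+\alpha_{21}^1$. $W_2$ is the subalgebra of $W(2)$ with basis $e_1,\dots,e_6$ (it consists of all commutative, i.e. symmetric, bilinear maps). A right ideal of an algebra $W$ is a subspace $I$ with $IW\subseteq I$; it is non-trivial if $I\neq 0$ and $I\neq W$. *)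

(* Defs.v *)
From HB Require Import structures.
From mathcomp Require Import all_boot all_order all_algebra.

Set Implicit Arguments.
Unset Strict Implicit.
Unset Printing Implicit Defensive.

Import GRing.Theory.
Local Open Scope ring_scope.

(* Bilinear maps V x V -> V are represented in curried form, so that they form *)
(* a vectType over F and their subspaces are elements of {vspace bilmap V}.    *)
Notation bilmap V := 'Hom(V, 'Hom(V, V)).

Section BilinearMaps.

Variables (F : fieldType) (V : vectType F).

(* The bilinear map given by f; meaningful only for bilinear f, see bilinE.    *)
Definition bilin (f : V -> V -> V) : bilmap V :=
  linfun (fun x => linfun (f x)).

Lemma bilinE (f : V -> V -> V) :
  (forall x, linear (f x)) -> (forall y, linear (f^~ y)) ->
  forall x y, bilin f x y = f x y.
Proof.
move=> fr fl x y.
have innerE u w : linfun (f u) w = f u w.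
  pose m := GRing.isLinear.Build _ _ _ _ _ (fr u).
  pose g : {linear V -> V} := HB.pack (f u) m.
  by rewrite -[f u]/(g : _ -> _) lfunE.
have outer : linear (fun u => linfun (f u)).
  move=> a u w; apply/lfunP=> z.
  by rewrite add_lfunE scale_lfunE !innerE fl.
pose m := GRing.isLinear.Build _ _ _ _ _ outer.
pose g : {linear V -> 'Hom(V, V)} := HB.pack (fun u => linfun (f u)) m.
by rewrite /bilin -[fun u => linfun (f u)]/(g : _ -> _) lfunE /= innerE.
Qed.

End BilinearMaps.

Section Algebra.

(* v is the basis v_1, v_2; indices are shifted by one, so that v_1 and v_2    *)
(* are v`_0 and v`_1.                                                          *)
Variables (F : fieldType) (V : vectType F) (v : 2.-tuple V).

Definition mulW (A B : bilmap V) : bilmap V :=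
  bilin (fun x y => A v`_0 (B x y) - B (A v`_0 x) y - B x (A v`_0 y)).

Lemma mulWE A B x y :
  mulW A B x y = A v`_0 (B x y) - B (A v`_0 x) y - B x (A v`_0 y).
Proof.
have comb a (p q r p' q' r' : V) : (a *: p + p') - (a *: q + q') - (a *: r + r')
    = a *: (p - q - r) + (p' - q' - r').
  by rewrite !scalerBr !opprD (addrACA (a *: p) p') (addrACA (a *: p - a *: q)).
have linl (C : bilmap V) a u w z : C (a *: u + w) z = a *: C u z + C w z.
  by rewrite linearP add_lfunE scale_lfunE.
by rewrite /mulW bilinE // => [{}x | {}y] a u w; rewrite -comb !(linl, linearP).
Qed.

Definition alpha (i j k : 'I_2) : bilmap V :=
  bilin (fun x y => (coord v i x * coord v j y) *: v`_k).

Lemma alphaE (hv : basis_of fullv v) (i j k t l : 'I_2) :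
  alpha i j k v`_t v`_l = ((i == t)%:R * (j == l)%:R) *: v`_k.
Proof.
have fv := basis_free hv.
rewrite /alpha bilinE ?coord_free // 1?(eq_sym i) 1?(eq_sym j) //.
- by move=> x a u w; rewrite linearP /= mulrDr scalerDl mulrCA scalerA.
- by move=> y a u w; rewrite linearP /= mulrDl scalerDl -mulrA scalerA.
Qed.

Definition e1 := alpha 0 0 0 - alpha 0 1 1 - alpha 1 0 1.
Definition e2 := alpha 0 0 1.
Definition e3 := alpha 1 1 1 - alpha 0 1 0 - alpha 1 0 0.
Definition e4 := alpha 1 1 0.
Definition e5 := 2 *: alpha 0 0 0 + alpha 0 1 1 + alpha 1 0 1.
Definition e6 := 2 *: alpha 1 1 1 + alpha 0 1 0 + alpha 1 0 0.

Definition W2 : {vspace bilmap V} := <<[:: e1; e2; e3; e4; e5; e6]>>%VS.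

Definition Annl : {vspace bilmap V} := <<[:: e4; (e3 + e6)%R]>>%VS.

Definition right_ideal (W I : {vspace bilmap V}) : Prop :=
  (I <= W)%VS /\ forall A B, A \in I -> B \in W -> mulW A B \in I.

Definition nontrivial_in (W I : {vspace bilmap V}) : Prop :=
  I <> 0%VS /\ I <> W.

End Algebra.

(* Main.v *)
(* The product A . B only involves the operator L = A(v_1, -), acting on      *)
(* symmetric bilinear maps as an element of gl(V), and Ann_l consists of the  *)
(* A in W_2 with L = 0.  The identity acts as -1, so a right ideal in which   *)
(* some element has L = 1 is the whole of W_2.  Starting from any L <> 0,     *)
(* repeated right multiplication and linear combinations lead to L = 1.       *)
Require Import Defs.
From mathcomp Require Import all_boot all_order all_algebra.
From mathcomp Require Import ring.
Import GRing.Theory.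
Local Open Scope ring_scope.

(** For A in I put L = A(v_1, -). The operators L obtained from I form a subspace, stable under L ->
    (A . B)(v_1, -) for every symmetric B ([right_ideal_op_closed]). In characteristic other than 2,
    any nonzero L leads to the identity ([op_closed_id]), and an A with L = 1 satisfies A . B = -B,
    which forces I = W_2 ([right_ideal_id]). So L = 0 on a proper I. A symmetric A with L = 0 is
    determined by A(v_2, v_2), hence lies in the span of e_4 and e_3 + e_6 = 3 alpha_22^2
    ([Annl_kernel]). *)

(* P a b c d stands for: some A in the right ideal has A(v_1, v_1) = (a, b)   *)
(* and A(v_1, v_2) = (c, d).  The last clause is the effect on A(v_1, -) of   *)
(* multiplying A on the right by the symmetric B with B(v_1, v_1) = (x, y),   *)
(* B(v_1, v_2) = (z, w) and B(v_2, v_2) = (s, t).                             *)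
Definition op_closed {F : fieldType} (P : F -> F -> F -> F -> Prop) : Prop :=
  [/\ forall k a b c d, P a b c d -> P (k * a) (k * b) (k * c) (k * d),
      forall a b c d a' b' c' d',
        P a b c d -> P a' b' c' d' -> P (a + a') (b + b') (c + c') (d + d')
    & forall a b c d x y z w s t, P a b c d ->
        P (y * c - a * x - 2 * (b * z)) (b * x + (d - 2 * a) * y - 2 * (b * w))
          (w * c - c * x - d * z - b * s) (b * z - c * y - a * w - b * t)].

(** The case b != 0 is solved directly; every other case is brought back to it by multiplying by B =
    e_2 or B = alpha_11^1. *)
Lemma op_closed_id {F : fieldType} {P : F -> F -> F -> F -> Prop}
    {a b c d : F} :
  op_closed P -> (2 : F) != 0 -> P a b c d ->
  [|| a != 0, b != 0, c != 0 | d != 0] -> P 1 0 0 1.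
Proof.
case=> PZ PD PM n2.
have Pb a' b' c' d' : b' != 0 -> P a' b' c' d' -> P 1 0 0 1.
  (* B supported on (v_2, v_2) only contributes -b B(v_2, v_2) to the image of v_2, so that image is
     arbitrary. Then e_2 turns v_2 -> v_1 into diag(1, -1), and adding 2 diag(0, 1) gives the
     identity. *)
  move=> nb /PM H.
  have P01 : P 0 0 0 1 by have := H 0 0 0 0 0 (- b'^-1); congr P; field.
  have P10 : P 0 0 1 0 by have := H 0 0 0 0 (- b'^-1) 0; congr P; field.
  have PH : P 1 0 0 (-1) by have := PM _ _ _ _ 0 1 0 0 0 0 P10; congr P; ring.
  by have := PD _ _ _ _ _ _ _ _ PH (PZ 2 _ _ _ _ P01); congr P; ring.
have Pd a' c' d' : d' - 2 * a' != 0 -> P a' 0 c' d' -> P 1 0 0 1.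
  (* Multiplying by e_2 makes d' - 2a' the new entry b. *)
  move=> nd H; apply: (Pb c' (d' - 2 * a') 0 (- c')) => //.
  by have := PM _ _ _ _ 0 1 0 0 0 0 H; congr P; ring.
have Pa a' c' d' : a' != 0 -> P a' 0 c' d' -> P 1 0 0 1.
  move=> na H; have [E|/Pd/(_ H)//] := eqVneq (d' - 2 * a') 0.
  (* Here d' = 2a'. Multiplying by alpha_11^1 gives the entries -a', 0, -c', 0, for which d - 2a
     becomes 2a'; this needs 2 != 0. *)
  apply: (Pd (- a') (- c') 0); first by rewrite sub0r mulrN opprK mulf_neq0.
  by have := PM _ _ _ _ 1 0 0 0 0 0 H; congr P; ring.
move=> H; have [b0|/Pb/(_ H)//] := eqVneq b 0; rewrite {}b0 in H *.
have [a0|/Pa/(_ H)//] := eqVneq a 0; rewrite {}a0 in H *.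
have [d0|nd _] := eqVneq d 0; last by apply: Pd H; rewrite mulr0 subr0.
(* Only c survives; e_2 turns it into diag(c, -c). *)
rewrite /= orbF => nc; apply: (Pa c 0 (- c)) => //.
by rewrite d0 in H; have := PM _ _ _ _ 0 1 0 0 0 0 H; congr P; ring.
Qed.

Section PlaneAlgebra.

Variables (F : fieldType) (V : vectType F) (v : 2.-tuple V).
Hypothesis hv : basis_of fullv v.

Definition comb (a b : F) : V := a *: v`_0 + b *: v`_1.

Lemma plane_decomp (x : V) : exists a b, x = comb a b.
Proof.
have /coord_basis/(_ (memvf x)) := hv.
by rewrite !big_ord_recl big_ord0 addr0 => E; do 2 eexists; exact: E.
Qed.

Lemma combD a b c d : comb a b + comb c d = comb (a + c) (b + d).
Proof. by rewrite /comb !scalerDl addrACA. Qed.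

Lemma combZ k a b : k *: comb a b = comb (k * a) (k * b).
Proof. by rewrite /comb scalerDr !scalerA. Qed.

Lemma combN a b : - comb a b = comb (- a) (- b).
Proof. by rewrite -scaleN1r combZ !mulN1r. Qed.

Lemma comb10 : v`_0 = comb 1 0.
Proof. by rewrite /comb scale1r scale0r addr0. Qed.

Lemma comb01 : v`_1 = comb 0 1.
Proof. by rewrite /comb scale1r scale0r add0r. Qed.

Lemma comb00 : 0 = comb 0 0.
Proof. by rewrite /comb !scale0r addr0. Qed.

Definition combE := (combZ, combN, combD).

Lemma lfun_comb (U : vectType F) (f : 'Hom(V, U)) a b :
  f (comb a b) = a *: f v`_0 + b *: f v`_1.
Proof. by rewrite linearD !linearZ. Qed.

Lemma bilmap_combl (A : bilmap V) a b y :
  A (comb a b) y = a *: A v`_0 y + b *: A v`_1 y.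
Proof. by rewrite lfun_comb add_lfunE !scale_lfunE. Qed.

Lemma bilmapP (A B : bilmap V) :
  A v`_0 v`_0 = B v`_0 v`_0 -> A v`_0 v`_1 = B v`_0 v`_1 ->
  A v`_1 v`_0 = B v`_1 v`_0 -> A v`_1 v`_1 = B v`_1 v`_1 -> A = B.
Proof.
move=> E00 E01 E10 E11; apply/lfunP=> x; apply/lfunP=> y.
have [a [b ->]] := plane_decomp x; have [c [d ->]] := plane_decomp y.
by rewrite !bilmap_combl !lfun_comb E00 E01 E10 E11.
Qed.

(** The values of the e_i are taken at [v]_0[and]v[_1] with natural-number indices, which [alphaE]
    does not match syntactically. *)
Lemma alphaE_nat (i j k : 'I_2) (t l : nat) : (t < 2)%N -> (l < 2)%N ->
  alpha v i j k v`_t v`_l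
    = ((nat_of_ord i == t)%:R * (nat_of_ord j == l)%:R) *: v`_k.
Proof.
by move=> t2 l2; rewrite -(alphaE hv i j k (Ordinal t2) (Ordinal l2)).
Qed.

Definition sym_values (A : bilmap V) (p1 p2 q1 q2 r1 r2 : F) : Prop :=
  [/\ A v`_0 v`_0 = comb p1 p2, A v`_0 v`_1 = comb q1 q2,
      A v`_1 v`_0 = comb q1 q2 & A v`_1 v`_1 = comb r1 r2].

Lemma sym_values_inj (A B : bilmap V) p1 p2 q1 q2 r1 r2 :
  sym_values A p1 p2 q1 q2 r1 r2 -> sym_values B p1 p2 q1 q2 r1 r2 -> A = B.
Proof.
by move=> [A00 A01 A10 A11] [B00 B01 B10 B11]; apply: bilmapP;
  rewrite ?(A00, A01, A10, A11).
Qed.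

Lemma sym_valuesD {A B : bilmap V} {p1 p2 q1 q2 r1 r2}
    {p1' p2' q1' q2' r1' r2'} :
  sym_values A p1 p2 q1 q2 r1 r2 -> sym_values B p1' p2' q1' q2' r1' r2' ->
  sym_values (A + B)
    (p1 + p1') (p2 + p2') (q1 + q1') (q2 + q2') (r1 + r1') (r2 + r2').
Proof.
by move=> [A00 A01 A10 A11] [B00 B01 B10 B11]; split; rewrite !add_lfunE
  ?(A00, A01, A10, A11) ?(B00, B01, B10, B11) combD.
Qed.

Lemma sym_valuesZ k {A : bilmap V} {p1 p2 q1 q2 r1 r2} :
  sym_values A p1 p2 q1 q2 r1 r2 ->
  sym_values (k *: A) (k * p1) (k * p2) (k * q1) (k * q2) (k * r1) (k * r2).
Proof.
by move=> [A00 A01 A10 A11]; split; rewrite !scale_lfunE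
  ?(A00, A01, A10, A11) combZ.
Qed.

Ltac eval_alpha :=
  split; rewrite ?(add_lfunE, opp_lfunE, scale_lfunE) !alphaE_nat //=
    ?(mulr0, mul0r, mulr1) ?(scale0r, scale1r) ?comb10 ?comb01 ?comb00 ?combE;
  congr comb; ring.

Lemma e1_values : sym_values (e1 v) 1 0 0 (-1) 0 0.
Proof. rewrite /e1; eval_alpha. Qed.

Lemma e2_values : sym_values (e2 v) 0 1 0 0 0 0.
Proof. rewrite /e2; eval_alpha. Qed.

Lemma e3_values : sym_values (e3 v) 0 0 (-1) 0 0 1.
Proof. rewrite /e3; eval_alpha. Qed.

Lemma e4_values : sym_values (e4 v) 0 0 0 0 1 0.
Proof. rewrite /e4; eval_alpha. Qed.

Lemma e5_values : sym_values (e5 v) 2 0 0 1 0 0.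
Proof. rewrite /e5; eval_alpha. Qed.

Lemma e6_values : sym_values (e6 v) 0 0 1 0 0 2.
Proof. rewrite /e6; eval_alpha. Qed.

Lemma span_sym (s : seq (bilmap V)) (B : bilmap V) :
  {in s, forall A : bilmap V, A v`_0 v`_1 = A v`_1 v`_0} ->
  B \in <<s>>%VS -> B v`_0 v`_1 = B v`_1 v`_0.
Proof.
move=> sym_s /(@coord_span _ _ _ (in_tuple s)) ->.
rewrite !sum_lfunE; apply: eq_bigr => i _.
by rewrite !scale_lfunE sym_s // mem_nth.
Qed.

Lemma W2_sym (B : bilmap V) : B \in W2 v -> B v`_0 v`_1 = B v`_1 v`_0.
Proof.
apply: span_sym => A; rewrite !inE.
have H (C : bilmap V) p1 p2 q1 q2 r1 r2 :
    sym_values C p1 p2 q1 q2 r1 r2 -> A == C -> A v`_0 v`_1 = A v`_1 v`_0.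
  by move=> [_ C01 C10 _] /eqP->; rewrite C01 C10.
by case/orP=> [|/or4P[|||/orP[]]]; apply: H;
  [exact: e1_values | exact: e2_values | exact: e3_values
  | exact: e4_values | exact: e5_values | exact: e6_values].
Qed.

Hypothesis n3 : (3 : F) != 0.

(** Inverts the coordinate change from the alpha's to the e_i: e_1 + e_5, e_6 - 2 e_3, e_5 - 2 e_1
    and e_3 + e_6 are each 3 times a symmetrised alpha, hence the division by 3. With [W2_sym] it
    shows that W_2 is all symmetric maps. *)
Definition sym_map (p1 p2 q1 q2 r1 r2 : F) : bilmap V :=
  (p1 / 3) *: (e1 v + e5 v) + (p2 *: e2 v + ((q1 / 3) *: (e6 v + (-2) *: e3 v)
    + ((q2 / 3) *: (e5 v + (-2) *: e1 v)
    + (r1 *: e4 v + (r2 / 3) *: (e3 v + e6 v))))).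

Lemma sym_mapP p1 p2 q1 q2 r1 r2 :
  sym_values (sym_map p1 p2 q1 q2 r1 r2) p1 p2 q1 q2 r1 r2.
Proof.
have h15 := sym_valuesZ (p1 / 3) (sym_valuesD e1_values e5_values).
have h2 := sym_valuesZ p2 e2_values.
have h63 := sym_valuesZ (q1 / 3)
  (sym_valuesD e6_values (sym_valuesZ (-2) e3_values)).
have h51 := sym_valuesZ (q2 / 3)
  (sym_valuesD e5_values (sym_valuesZ (-2) e1_values)).
have h4 := sym_valuesZ r1 e4_values.
have h36 := sym_valuesZ (r2 / 3) (sym_valuesD e3_values e6_values).
have := sym_valuesD h15 (sym_valuesD h2
  (sym_valuesD h63 (sym_valuesD h51 (sym_valuesD h4 h36)))).
by congr sym_values; field.
Qed.

Lemma sym_map_W2 p1 p2 q1 q2 r1 r2 : sym_map p1 p2 q1 q2 r1 r2 \in W2 v.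
Proof.
rewrite /sym_map /W2.
(* The e_i are made opaque, so that [memvD] does not split them into alpha's. *)
move: (e1 v) (e2 v) (e3 v) (e4 v) (e5 v) (e6 v) => f1 f2 f3 f4 f5 f6.
by do ![apply: memvD | apply: memvZ];
  apply: memv_span; rewrite !inE eqxx ?orbT.
Qed.

Lemma Annl_kernel (A : bilmap V) : A \in W2 v -> A v`_0 = 0 -> A \in Annl v.
Proof.
move=> /W2_sym sA A0; have [r1 [r2 E11]] := plane_decomp (A v`_1 v`_1).
have A0' x : A v`_0 x = comb 0 0 by rewrite A0 lfunE -comb00.
have -> : A = sym_map 0 0 0 0 r1 r2.
  by apply: sym_values_inj (sym_mapP _ _ _ _ _ _); split; rewrite -?sA.
rewrite /sym_map /Annl; move: (e3 v + e6 v)%R (e4 v) => f g.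
rewrite !(mul0r, scale0r, add0r).
by apply: memvD; apply: memvZ; apply: memv_span; rewrite !inE eqxx ?orbT.
Qed.

Lemma right_ideal_op_closed (I : {vspace bilmap V}) : right_ideal v (W2 v) I ->
  op_closed (fun a b c d => exists A,
    [/\ A \in I, A v`_0 v`_0 = comb a b & A v`_0 v`_1 = comb c d]).
Proof.
move=> [_ mulI]; split.
- move=> k a b c d [A [AI E0 E1]]; exists (k *: A).
  by split; [rewrite memvZ | |]; rewrite // !scale_lfunE ?E0 ?E1 combZ.
- move=> a b c d a' b' c' d' [A [AI E0 E1]] [B [BI G0 G1]]; exists (A + B).
  by split; [rewrite memvD | |]; rewrite // !add_lfunE ?E0 ?E1 ?G0 ?G1 combD.
move=> a b c d x y z w s t [A [AI E0 E1]].
have [] := sym_mapP x y z w s t; have := sym_map_W2 x y z w s t.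
move: (sym_map _ _ _ _ _ _) => B BW B00 B01 B10 B11.
exists (mulW v A B); split; first exact: mulI.
  rewrite mulWE B00 E0 bilmap_combl !lfun_comb E0 E1 B00 B10 B01 !combE.
  by congr comb; ring.
rewrite mulWE B01 E0 E1 bilmap_combl !lfun_comb E0 E1 B00 B01 B11 !combE.
by congr comb; ring.
Qed.

Lemma right_ideal_id (I : {vspace bilmap V}) (A : bilmap V) :
  right_ideal v (W2 v) I -> A \in I ->
  A v`_0 v`_0 = v`_0 -> A v`_0 v`_1 = v`_1 -> I = W2 v.
Proof.
move=> [sIW mulI] AI E0 E1; apply/eqP; rewrite eqEsubv sIW.
have EA x : A v`_0 x = x.
  by have [a [b ->]] := plane_decomp x; rewrite lfun_comb E0 E1.
apply/subvP=> B /(mulI _ _ AI); rewrite -memvN; congr (_ \in I).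
apply/lfunP=> x; apply/lfunP=> y.
by rewrite !opp_lfunE mulWE !EA subrr sub0r.
Qed.

End PlaneAlgebra.

Theorem lemma3 (F : fieldType) (charF : [pchar F] =i pred0)
    (V : vectType F) (v : 2.-tuple V) (hv : basis_of fullv v)
    (I : {vspace bilmap V}) :
  right_ideal v (W2 v) I -> nontrivial_in (W2 v) I -> (I <= Annl v)%VS.
Proof.
move=> rI [_ nIW]; apply/subvP=> A AI.
(* Characteristic zero enters only through 2 != 0 and 3 != 0. *)
have nz k : k.+1%:R != 0 :> F by rewrite ((pcharf0P F).1 charF).
have [n2 n3] := (nz 1%N, nz 2%N).
have [a [b E0]] := plane_decomp _ _ _ hv (A v`_0 v`_0).
have [c [d E1]] := plane_decomp _ _ _ hv (A v`_0 v`_1).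
have [abcd | ] := boolP [|| a != 0, b != 0, c != 0 | d != 0].
  have [] // := op_closed_id (right_ideal_op_closed _ _ _ hv n3 _ rI) n2 _ abcd.
    by exists A.
  move=> B [BI B0 B1]; case: nIW; apply: (right_ideal_id _ _ _ hv _ B rI BI).
    by rewrite B0 -comb10.
  by rewrite B1 -comb01.
rewrite !negb_or !negbK => /and4P[/eqP a0 /eqP b0 /eqP c0 /eqP d0].
apply: Annl_kernel => //; first exact: subvP rI.1 _ AI.
apply/lfunP=> x; have [p [q ->]] := plane_decomp _ _ _ hv x.
by rewrite lfun_comb E0 E1 a0 b0 c0 d0 -comb00 !scaler0 addr0 lfunE.
Qed.
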